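(* Let $G=(V,E,\sigma)$ be a connected signed graph with Gremban expansion $\mathcal{G}$, Gremban involution $\eta$ and projection map $\pi$. Let $V(\mathcal{G})=\mathcal{U}_1\cup\mathcal{U}_2$ be a Gremban-symmetric partition into two sets. Then the cut-set $C(\mathcal{U}_1,\mathcal{U}_2)\subseteq E(\mathcal{G})$ is Gremban-symmetric, and: (i) if $\eta(\mathcal{U}_1)=\mathcal{U}_2$ and $\eta(\mathcal{U}_2)=\mathcal{U}_1$, then $\pi(C(\mathcal{U}_1,\mathcal{U}_2))\subseteq E(G)$ is a frustration set of $G$; (ii) if $\eta(\mathcal{U}_1)=\mathcal{U}_1$ and $\eta(\mathcal{U}_2)=\mathcal{U}_2$, then $\pi(C(\mathcal{U}_1,\mathcal{U}_2))\subseteq E(G)$ is a cut-set of $G$. Conversely, every cut-set and every frustration set $F\subseteq E(G)$ lifts to the Gremban-symmetric cut-set $\pi^{-1}(F)$ of $\mathcal{G}$ (arising from a Gremban-symmetric partition of $V(\mathcal{G})$), and this correspondence $C\mapsto \pi(C)$, $F\mapsto\pi^{-1}(F)$ between such Gremban-symmetric cut-sets of $\mathcal{G}$ and the cut-sets and frustration sets of $G$ is a bijection.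
   Context: A signed graph $G=(V,E,\sigma)$ has a finite node set $V$ ($|V|=n$), a finite set $E$ of undirected edges (no self-loops, no multi-edges), and a sign function $\sigma:E\to\{\pm1\}$. The Gremban expansion $\mathcal{G}$ of $G$ is the unsigned graph with node set $\{v^\chi: v\in V,\ \chi\in\{+,-\}\}$ and edge set $\{(u^\chi, v^{\chi\cdot\sigma(u,v)}) : (u,v)\in E,\ \chi\in\{+,-\}\}$ (so a positive edge $uv$ yields $u^+v^+$ and $u^-v^-$; a negative edge yields $u^+v^-$ and $u^-v^+$). The Gremban involution is $\eta(v^\chi)=v^{-\chi}$, extended to edges by $\eta((a,b))=(\eta(a),\eta(b))$ and to sets elementwise. A node set or edge set $X$ is Gremban-symmetric if $\eta(X)=X$; a partition $V(\mathcal{G})=\mathcal{U}_1\cup\dots\cup\mathcal{U}_k$ is Gremban-symmetric if for each $i$, $\eta(\mathcal{U}_i)=\mathcal{U}_j$ for some $j$. The projection map is $\pi(v^\chi)=v$, extended to edges by $\pi((u^\chi,v^\psi))=(u,v)$ and to sets elementwise. For a partition $V=S\cup T$ of the nodes of a (signed or unsigned) graph, the cut-set is $C(S,T)=\{(u,v)\in E: u\in S, v\in T\}$. A switching function is $\theta:V\to\{\pm1\}$; its frustration set is $F(\theta)=\{uv\in E: \theta(u)\theta(v)\sigma(uv)=-1\}$. A frustration set of $G$ is any set of the form $F(\theta)$. *)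

(* Defs.v *)
From mathcomp Require Import all_boot.

Set Implicit Arguments.
Unset Strict Implicit.
Unset Printing Implicit Defensive.

(** The sign [b : sign] stands for (-1) ^+ b: [false] is +1, [true] is -1 and
    the product of signs is [addb], written [(+)]. *)
Notation sign := bool (only parsing).

(** An edge uv is the unordered pair [[set u; v]]. *)
Record graph (V : finType) := Graph {
  edges : {set {set V}};
  edges_card2 : forall e, e \in edges -> #|e| = 2
}.

(** Only the values of [sigma] on [edges] are ever used. *)
Record signed_graph (V : finType) := SignedGraph {
  underlying :> graph V;
  sigma : {set V} -> sign
}.

Definition adj (V : finType) (G : graph V) : rel V :=
  [rel u v | [set u; v] \in edges G].

(** The null graph is not connected. *)
Definition connected (V : finType) (G : graph V) : Prop :=
  0 < #|V| /\ forall u v : V, connect (adj G) u v.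

(** As for any [partition], both parts are nonempty; [S != T] excludes the
    one-block partition, for which [[set S; T]] is a singleton. *)
Definition bipartition (V : finType) (S T : {set V}) : bool :=
  (S != T) && partition [set S; T] [set: V].

Definition cutset (V : finType) (G : graph V) (S T : {set V}) : {set {set V}} :=
  [set e in edges G | [exists u in S, exists v in T, e == [set u; v]]].

Definition cutsets (V : finType) (G : graph V) : {set {set {set V}}} :=
  [set F | [exists S, exists T, bipartition S T && (F == cutset G S T)]].

Definition frustration (V : finType) (G : signed_graph V) (theta : V -> sign) :
    {set {set V}} :=
  [set e in edges G | [exists u, exists v,
     (e == [set u; v]) && (theta u (+) theta v (+) sigma G e == true)]].

Definition frustration_sets (V : finType) (G : signed_graph V) :
    {set {set {set V}}} :=
  [set F | [exists theta : {ffun V -> sign}, F == frustration G theta]].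

Section Expansion.
Variable V : finType.
Implicit Type G : signed_graph V.

(** The node v^chi of the expansion is the pair [(v, chi)]. *)
Definition gremban_edges G : {set {set V * sign}} :=
  [set e | [exists u, exists v, exists chi,
     ([set u; v] \in edges G) &&
     (e == [set (u, chi); (v, chi (+) sigma G [set u; v])])]].

Lemma gremban_edges_card2 G e : e \in gremban_edges G -> #|e| = 2.
Proof.
rewrite inE => /existsP[u /existsP[v /existsP[chi /andP[uvG /eqP->]]]].
have := edges_card2 uvG; rewrite !cards2 => -[].
by rewrite xpair_eqE; case: (u == v).
Qed.

Definition gremban G : graph (V * sign)%type := Graph (@gremban_edges_card2 G).

Definition eta (x : V * sign) : V * sign := (x.1, ~~ x.2).
Definition eta_set (U : {set V * sign}) : {set V * sign} := eta @: U.
Definition eta_edges (C : {set {set V * sign}}) : {set {set V * sign}} :=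
  eta_set @: C.

Definition symmetric_partition (P : {set {set V * sign}}) : bool :=
  partition P [set: V * sign] && [forall U in P, eta_set U \in P].

Definition symmetric_bipartition (U1 U2 : {set V * sign}) : bool :=
  (U1 != U2) && symmetric_partition [set U1; U2].

Definition pi (x : V * sign) : V := x.1.
Definition pi_edges (C : {set {set V * sign}}) : {set {set V}} :=
  [set pi @: e | e : {set V * sign} in C].

Definition pi_preim G (F : {set {set V}}) : {set {set V * sign}} :=
  [set e in edges (gremban G) | pi @: e \in F].

Definition symmetric_cutsets G : {set {set {set V * sign}}} :=
  [set C | (eta_edges C == C) &&
     [exists U1, exists U2,
        symmetric_bipartition U1 U2 && (C == cutset (gremban G) U1 U2)]].

End Expansion.

(* Main.v *)
Require Import Defs.
From mathcomp Require Import all_boot.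

Set Implicit Arguments.
Unset Strict Implicit.
Unset Printing Implicit Defensive.

(** The symmetric bipartitions of the expansion are of two kinds: [eta] fixes
    both parts, and [U1] is the preimage by [pi] of a set of nodes [S], or [eta]
    swaps them, and [U1] is the set of the v^chi with theta(v) * chi = -1 for a
    switching function [theta].  Their cut-sets are the lifts of [cutset G S T]
    and of [frustration G theta] respectively.  As a lift is always symmetric
    and [pi_edges] undoes [pi_preim] on sets of edges, everything follows from
    these two computations. *)

(** * Unordered pairs and partitions into two blocks *)

Lemma set2_inj (T : finType) (a b c d : T) :
  [set a; b] = [set c; d] -> a = c /\ b = d \/ a = d /\ b = c.
Proof.
move=> E; have := (set21 a b, set22 a b); rewrite E !in_set2.
have := (set21 c d, set22 c d); rewrite -E !in_set2.
by case=> /orP[]/eqP ? /orP[]/eqP ? [/orP[]/eqP ? /orP[]/eqP ?]; subst; auto.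
Qed.

Lemma bipartitionE (V : finType) (S T : {set V}) :
  bipartition S T = [&& S != set0, T != set0 & T == ~: S].
Proof.
rewrite /bipartition /partition !inE negb_or.
rewrite [set0 == S]eq_sym [set0 == T]eq_sym.
case: eqVneq => [<-|neqST] /=.
  (* When the blocks coincide, the right-hand side must fail too: a nonempty set is not its own
     complement. *)
  case: eqVneq => //= S0; apply/esym/negbTE/eqP => eqS.
  by case/set0Pn: S0 => x xS; move: (xS); rewrite {1}eqS inE xS.
rewrite [LHS]andbA [LHS]andbC -[LHS]andbA; do 2!congr (_ && _).
(* [trivIset] compares the sum of the block sizes with the size of the union; for two distinct
   blocks, equality means disjointness. *)
rewrite /trivIset /cover !big_setU1 ?inE ?big_set1 //= andbC.
rewrite eq_sym (leq_card_setU S T).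
apply/andP/eqP => [[dST /eqP cST]|->].
  apply/setP => x; rewrite inE; have := in_setT x; rewrite -cST inE.
  by case: (boolP (x \in S)) => //= xS _; rewrite (disjointFr dST).
by rewrite setUCr eqxx -setI_eq0 setICr eqxx.
Qed.

(** * Edges and cut-sets of a graph *)

Section GraphCuts.
Variables (V : finType) (G : graph V).
Implicit Types (S T : {set V}) (F : {set {set V}}).

Lemma edge_set2 e : e \in edges G -> exists u v, e = [set u; v].
Proof. by move=> /edges_card2/eqP/cards2P[u [v [_ ->]]]; exists u, v. Qed.

(** The exclusive or is symmetric in the endpoints, so the criterion does not depend on the order in
    which the unordered edge is written. *)
Lemma mem_cutset S u v :
  ([set u; v] \in cutset G S (~: S)) =
  ([set u; v] \in edges G) && ((u \in S) (+) (v \in S)).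
Proof.
rewrite inE; congr (_ && _); apply/idP/idP.
  case/existsP=> a /andP[aS /existsP[b /andP[]]]; rewrite inE => /negbTE bS.
  by move=> /eqP/set2_inj[][-> ->]; rewrite aS bS.
case: (boolP (u \in S)) (boolP (v \in S)) => uS [] vS //= _.
  by apply/existsP; exists u; rewrite uS; apply/existsP; exists v; rewrite inE vS /=.
apply/existsP; exists v; rewrite vS; apply/existsP; exists u.
by rewrite inE uS setUC /=.
Qed.

Lemma cutsetsP F :
  reflect (exists2 S, bipartition S (~: S) & F = cutset G S (~: S))
          (F \in cutsets G).
Proof.
rewrite inE; apply: (iffP existsP) => [[S /existsP[T /andP[bST /eqP->]]]|].
  move: (bST); rewrite bipartitionE => /and3P[_ _ /eqP eqT].
  by exists S; rewrite -eqT.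
by case=> S bS ->; exists S; apply/existsP; exists (~: S); rewrite bS eqxx.
Qed.

Lemma cutsets_sub F : F \in cutsets G -> F \subset edges G.
Proof. by case/cutsetsP=> S _ ->; apply/subsetP => e; rewrite inE => /andP[]. Qed.

End GraphCuts.

(** * Frustration sets, edges of the expansion, and its involution and projection *)

Section Expansion.
Variables (V : finType) (G : signed_graph V).
Implicit Types (S : {set V}) (F : {set {set V}}) (U : {set V * bool}).
Implicit Types (x y : V * bool) (theta : V -> bool).

Lemma mem_frustration theta u v :
  ([set u; v] \in frustration G theta) =
  ([set u; v] \in edges G) && (theta u (+) theta v (+) sigma G [set u; v]).
Proof.
rewrite inE; congr (_ && _); apply/idP/idP.
  case/existsP=> a /existsP[b /andP[/eqP/set2_inj[][-> ->] /eqP]] //.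
  by rewrite (addbC (theta a)).
by move=> H; apply/existsP; exists u; apply/existsP; exists v; rewrite eqxx H.
Qed.

Lemma frustration_setsP F :
  reflect (exists theta, F = frustration G theta) (F \in frustration_sets G).
Proof.
rewrite inE; apply: (iffP existsP) => [[theta /eqP->]|[theta ->]].
  by exists theta.
(* The definition quantifies over finite functions; [frustration] depends only on the values of
   [theta], which is checked edge by edge. *)
exists [ffun v => theta v]; apply/eqP/setP => e.
case: (boolP (e \in edges G)) => [eG|/negbTE eG]; last by rewrite !inE eG.
by have [u [v ->]] := edge_set2 eG; rewrite !mem_frustration !ffunE.
Qed.

Lemma frustration_sets_sub F : F \in frustration_sets G -> F \subset edges G.
Proof.
by case/frustration_setsP=> t ->; apply/subsetP => e; rewrite inE => /andP[].
Qed.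

Lemma mem_gremban x y :
  ([set x; y] \in edges (gremban G)) =
  ([set x.1; y.1] \in edges G) && (x.2 (+) y.2 == sigma G [set x.1; y.1]).
Proof.
case: x y => [u a] [v b] /=; rewrite inE; apply/idP/idP.
  case/existsP=> w /existsP[z /existsP[c /andP[wzG /eqP/set2_inj]]].
  case=> -[[-> ->] [-> ->]]; first by rewrite wzG addKb eqxx.
  by rewrite setUC wzG addbC addKb eqxx.
case/andP=> uvG /eqP Es; apply/existsP; exists u; apply/existsP; exists v.
by apply/existsP; exists a; rewrite uvG -Es addKb eqxx.
Qed.

Lemma etaK : involutive (@eta V).
Proof. by case=> v a; rewrite /eta negbK. Qed.

Lemma mem_eta_set U x : (x \in eta_set U) = (eta x \in U).
Proof. by rewrite -{1}[x]etaK mem_imset //; apply: can_inj etaK. Qed.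

Lemma eta_setK : involutive (@eta_set V).
Proof. by move=> U; apply/setP => x; rewrite !mem_eta_set etaK. Qed.

Lemma eta_setC U : eta_set (~: U) = ~: eta_set U.
Proof. by apply/setP => x; rewrite !(mem_eta_set, inE). Qed.

Lemma eta_set2 x y : eta_set [set x; y] = [set eta x; eta y].
Proof. by rewrite /eta_set imsetU1 imset_set1. Qed.

Lemma pi_set2 x y : @Defs.pi V @: [set x; y] = [set x.1; y.1].
Proof. by rewrite imsetU1 imset_set1. Qed.

Lemma mem_pi_preim F x y :
  ([set x; y] \in pi_preim G F) =
  ([set x; y] \in edges (gremban G)) && ([set x.1; y.1] \in F).
Proof. by rewrite inE pi_set2. Qed.

Lemma pi_preim_sub F : pi_preim G F \subset edges (gremban G).
Proof. by apply/subsetP => e; rewrite inE => /andP[]. Qed.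

Lemma gremban_edgesP (C D : {set {set V * bool}}) :
  C \subset edges (gremban G) -> D \subset edges (gremban G) ->
  (forall x y, [set x; y] \in edges (gremban G) ->
     ([set x; y] \in C) = ([set x; y] \in D)) -> C = D.
Proof.
move=> /subsetP sC /subsetP sD eqCD; apply/setP => e.
case: (boolP (e \in edges (gremban G))) => [eG|/negP eG].
  by have [x [y exy]] := edge_set2 eG; rewrite exy in eG *; apply: eqCD.
by apply/idP/idP => [/sC|/sD].
Qed.

(** Flipping both signs keeps their product and the projected edge, so [eta] maps a lift into
    itself; being an involution, it maps it onto itself. *)
Lemma eta_edges_pi_preim F : eta_edges (pi_preim G F) = pi_preim G F.
Proof.
have sub e : e \in pi_preim G F -> eta_set e \in pi_preim G F.
  move=> eF; have eG := subsetP (pi_preim_sub F) _ eF.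
  have [x [y exy]] := edge_set2 eG; move: eF; rewrite exy eta_set2.
  by rewrite !mem_pi_preim !mem_gremban /= addbN addNb negbK.
apply/setP => e; apply/imsetP/idP => [[f fF ->]|eF]; first exact: sub.
by exists (eta_set e); rewrite ?eta_setK ?sub.
Qed.

Lemma pi_preimK F : F \subset edges G -> pi_edges (pi_preim G F) = F.
Proof.
move=> /subsetP sF; apply/setP => f; apply/imsetP/idP => [[e]|fF].
  by rewrite inE => /andP[_ eF] ->.
have [u [v fuv]] := edge_set2 (sF _ fF); rewrite fuv in fF *.
(* The lift of uv that starts at u^+: the sign at v is then forced to be that of uv. *)
exists [set (u, false); (v, sigma G [set u; v])]; last by rewrite pi_set2.
by rewrite mem_pi_preim mem_gremban /= fF sF // eqxx.
Qed.

(** * Lifts of cut-sets and frustration sets as cut-sets of the expansion *)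

Lemma pi_preim_cutset S :
  pi_preim G (cutset G S (~: S)) =
  cutset (gremban G) (@Defs.pi V @^-1: S) (~: (@Defs.pi V @^-1: S)).
Proof.
apply: gremban_edgesP => [||x y xyG]; first exact: pi_preim_sub.
  by apply/subsetP => e; rewrite inE => /andP[].
rewrite mem_pi_preim !mem_cutset xyG !in_set.
by move: xyG; rewrite mem_gremban => /andP[->].
Qed.

Definition switching_nodes theta : {set V * bool} :=
  [set x | theta x.1 (+) x.2].

(** An edge from u^a to v^b crosses when theta(u) a theta(v) b = -1; as ab = sigma(uv) on edges of
    the expansion, this is the frustration condition for uv. *)
Lemma pi_preim_frustration theta :
  pi_preim G (frustration G theta) =
  cutset (gremban G) (switching_nodes theta) (~: switching_nodes theta).
Proof.
apply: gremban_edgesP => [||x y xyG]; first exact: pi_preim_sub.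
  by apply/subsetP => e; rewrite inE => /andP[].
rewrite mem_pi_preim mem_frustration mem_cutset xyG !in_set.
move: xyG; rewrite mem_gremban => /andP[-> /eqP <-] /=.
by rewrite addbACA.
Qed.

(** * Classification of the symmetric bipartitions *)

(** The blocks are complementary and [eta_set] commutes with complement, so the image of [U1]
    determines that of [U2]. *)
Lemma symmetric_bipartitionE U1 U2 :
  symmetric_bipartition U1 U2 =
  bipartition U1 U2 && ((eta_set U1 == U1) || (eta_set U1 == U2)).
Proof.
rewrite /symmetric_bipartition /symmetric_partition andbA -/(bipartition U1 U2).
case: (boolP (bipartition _ _)) => //=.
rewrite bipartitionE => /and3P[_ _ /eqP->]; apply/forall_inP/idP => [|etaU U].
  by move/(_ U1); rewrite !inE eqxx; apply.
rewrite !inE => /orP[]/eqP-> //; rewrite eta_setC.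
by case/orP: etaU => /eqP->; rewrite ?setCK eqxx ?orbT.
Qed.

Lemma symmetric_bipartition_pi S :
  symmetric_bipartition (@Defs.pi V @^-1: S) (~: (@Defs.pi V @^-1: S)) =
  bipartition S (~: S).
Proof.
have pi0 (T : {set V}) : (@Defs.pi V @^-1: T != set0) = (T != set0).
  apply/set0Pn/set0Pn => [[x]|[v vT]]; first by rewrite inE; exists x.1.
  by exists (v, false); rewrite inE.
rewrite symmetric_bipartitionE !bipartitionE -preimsetC !pi0 preimsetC !eqxx /=.
suff -> : eta_set (@Defs.pi V @^-1: S) = @Defs.pi V @^-1: S.
  by rewrite eqxx orTb andbT.
by apply/setP => x; rewrite mem_eta_set !inE.
Qed.

Lemma symmetric_bipartition_switching theta : 0 < #|V| ->
  symmetric_bipartition (switching_nodes theta) (~: switching_nodes theta).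
Proof.
case/card_gt0P=> v _; rewrite symmetric_bipartitionE bipartitionE eqxx andbT.
apply/andP; split.
  (* The two copies of any node v lie in opposite parts, so neither part is empty. *)
  by apply/andP; split; apply/set0Pn;
    [exists (v, ~~ theta v) | exists (v, theta v)]; rewrite !inE /= ?addbN addbb.
apply/orP; right; apply/eqP/setP => x.
by rewrite mem_eta_set !inE /= addbN.
Qed.

(** Both copies of a node are in [U] or both are out, so the copy v^+ decides. *)
Lemma eta_set_fixed U : eta_set U = U ->
  U = @Defs.pi V @^-1: [set v | (v, false) \in U].
Proof.
move=> etaU; apply/setP => -[v []]; rewrite !inE //=.
by rewrite -{1}etaU mem_eta_set.
Qed.

(** Exactly one copy of each node is in [U]; the switching function is -1 where that copy is v^+. *)
Lemma eta_set_swapped U : eta_set U = ~: U ->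
  U = switching_nodes (fun v => (v, false) \in U).
Proof.
move=> etaU; apply/setP => -[v []]; rewrite inE /= ?addbF // addbT.
by have := mem_eta_set U (v, false); rewrite etaU inE.
Qed.

(** * Symmetric cut-sets of the expansion are lifts *)

Lemma cutset_eta_fixed U1 U2 :
  symmetric_bipartition U1 U2 -> eta_set U1 = U1 ->
  exists2 F, F \in cutsets G & cutset (gremban G) U1 U2 = pi_preim G F.
Proof.
move=> symU etaU; move: (symU); rewrite symmetric_bipartitionE bipartitionE.
case/andP=> /and3P[_ _ /eqP eqU2] _; rewrite {}eqU2 in symU *.
rewrite (eta_set_fixed etaU) in symU *; rewrite symmetric_bipartition_pi in symU.
rewrite -pi_preim_cutset; eexists; last by [].
by apply/cutsetsP; eexists; first exact: symU.
Qed.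

Lemma cutset_eta_swapped U1 U2 :
  symmetric_bipartition U1 U2 -> eta_set U1 = U2 ->
  exists2 F, F \in frustration_sets G &
    cutset (gremban G) U1 U2 = pi_preim G F.
Proof.
rewrite symmetric_bipartitionE bipartitionE => /andP[/and3P[_ _ /eqP->] _].
move=> /eta_set_swapped->; rewrite -pi_preim_frustration.
by eexists; last by []; apply/frustration_setsP; eexists.
Qed.

Lemma cutset_symmetric U1 U2 : symmetric_bipartition U1 U2 ->
  exists2 F, F \in cutsets G :|: frustration_sets G &
    cutset (gremban G) U1 U2 = pi_preim G F.
Proof.
move=> symU; move: (symU); rewrite symmetric_bipartitionE => /andP[_].
by case/orP=> /eqP; [move/(cutset_eta_fixed symU) | move/(cutset_eta_swapped symU)];
  case=> F FG eqC; exists F; rewrite // inE FG ?orbT.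
Qed.

Lemma cutset_frustration_sub F :
  F \in cutsets G :|: frustration_sets G -> F \subset edges G.
Proof. by rewrite inE => /orP[/cutsets_sub|/frustration_sets_sub]. Qed.

Lemma pi_preim_symmetric F U : symmetric_bipartition U (~: U) ->
  pi_preim G F = cutset (gremban G) U (~: U) ->
  pi_preim G F \in symmetric_cutsets G.
Proof.
move=> symU eqF; rewrite inE eta_edges_pi_preim eqxx /=.
apply/existsP; exists U; apply/existsP; exists (~: U).
by rewrite symU eqF eqxx.
Qed.

Lemma symmetric_cutsets_pi_preim C : C \in symmetric_cutsets G ->
  exists2 F, F \in cutsets G :|: frustration_sets G & C = pi_preim G F.
Proof.
rewrite inE => /andP[_ /existsP[U1 /existsP[U2 /andP[symU /eqP->]]]].
exact: cutset_symmetric.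
Qed.

End Expansion.

Theorem theorem2 (V : finType) (G : signed_graph V) (hG : connected G) :
  (forall U1 U2 : {set V * bool}, symmetric_bipartition U1 U2 ->
     let C := cutset (gremban G) U1 U2 in
     [/\ eta_edges C = C,
         (eta_set U1 = U2 -> eta_set U2 = U1 ->
            pi_edges C \in frustration_sets G)
       & (eta_set U1 = U1 -> eta_set U2 = U2 ->
            pi_edges C \in cutsets G)]) /\
  [/\ (forall F : {set {set V}}, F \in cutsets G ->
         pi_preim G F \in symmetric_cutsets G),
      (forall F : {set {set V}}, F \in frustration_sets G ->
         pi_preim G F \in symmetric_cutsets G),
      (forall C : {set {set V * bool}}, C \in symmetric_cutsets G ->
         pi_edges C \in cutsets G :|: frustration_sets G),
      {in symmetric_cutsets G, cancel (@pi_edges V) (pi_preim G)}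
    & {in cutsets G :|: frustration_sets G,
         cancel (pi_preim G) (@pi_edges V)}].
Proof.
(* A node must exist for the two parts defined by a switching function to be nonempty. *)
have [V_gt0 _] := hG; split=> [U1 U2 symU C|].
  split=> [|etaU _|etaU _].
  - by rewrite /C; have [F _ ->] := cutset_symmetric G symU;
      exact: eta_edges_pi_preim.
  - have [F FG eqC] := cutset_eta_swapped G symU etaU.
    by rewrite /C eqC pi_preimK // frustration_sets_sub.
  - have [F FG eqC] := cutset_eta_fixed G symU etaU.
    by rewrite /C eqC pi_preimK // cutsets_sub.
split=> [F|F|C|C|F].
- case/cutsetsP=> S bS ->; apply: pi_preim_symmetric (pi_preim_cutset G S).
  by rewrite symmetric_bipartition_pi.
- case/frustration_setsP=> theta ->.
  apply: pi_preim_symmetric (pi_preim_frustration G theta).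
  exact: symmetric_bipartition_switching.
- by case/symmetric_cutsets_pi_preim=> F FG ->;
    rewrite pi_preimK ?cutset_frustration_sub.
(* Once C is written as the lift of some F, projecting gives back F, and lifting again gives C. *)
- by case/symmetric_cutsets_pi_preim=> F FG ->;
    rewrite pi_preimK ?cutset_frustration_sub.
- by move=> FG; rewrite pi_preimK ?cutset_frustration_sub.
Qed.
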